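(* Let $G$ be a finite group and $S$ a finite ring. Then the following statements hold: (1) The group ring $S[G]$ is additively generated by units if and only if $S$ is additively generated by units. (2) $S$ has the $2$-sum property if and only if $S[G]$ has the $2$-sum property.
   Context: Rings are unital, with $0\neq 1$, not necessarily commutative. A ring is additively generated by units if its additive group is generated by its units. A ring $R$ has the $n$-sum property if every element of $R$ can be written as the sum of exactly $n$ elements of the unit group $R^\times$. *)

(* Defs.v *)
From HB Require Import structures.
From mathcomp Require Import all_boot all_fingroup all_algebra.

Set Implicit Arguments.
Unset Strict Implicit.
Unset Printing Implicit Defensive.

Import GRing.Theory.
Local Open Scope ring_scope.

(* The group ring S[G]: the element with coefficient function f is the formal
   sum \sum_g f(g) g.  This is a wrapper rather than an alias, because
   {ffun G -> S} already has a canonical ring structure, with the pointwise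
   product. *)
Record group_ring (S : nzRingType) (G : finGroupType) : Type :=
  GroupRing { gcoef : {ffun G -> S} }.

Section GroupRing.
Variables (S : nzRingType) (G : finGroupType).
Local Notation SG := (group_ring S G).
Implicit Types a b c : SG.

HB.instance Definition _ := [isNew for @gcoef S G].
HB.instance Definition _ := [Choice of SG by <:].

Lemma gcoefP a b : (forall g, gcoef a g = gcoef b g) <-> a = b.
Proof.
split=> [eq_ab|-> //].
by apply: val_inj; apply/ffunP => g; apply: eq_ab.
Qed.

Definition gr_zero : SG := GroupRing [ffun=> 0].
Definition gr_opp a : SG := GroupRing [ffun g => - gcoef a g].
Definition gr_add a b : SG := GroupRing [ffun g => gcoef a g + gcoef b g].
Definition gr_one : SG := GroupRing [ffun g => (g == 1%g)%:R].
Definition gr_mul a b : SG :=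
  GroupRing [ffun g => \sum_(h : G) gcoef a h * gcoef b (h^-1 * g)%g].

Fact gr_addA : associative gr_add.
Proof. by move=> a b c; apply/gcoefP => g; rewrite !ffunE addrA. Qed.
Fact gr_addC : commutative gr_add.
Proof. by move=> a b; apply/gcoefP => g; rewrite !ffunE addrC. Qed.
Fact gr_add0 : left_id gr_zero gr_add.
Proof. by move=> a; apply/gcoefP => g; rewrite !ffunE add0r. Qed.
Fact gr_addN : left_inverse gr_zero gr_opp gr_add.
Proof. by move=> a; apply/gcoefP => g; rewrite !ffunE addNr. Qed.

HB.instance Definition _ :=
  GRing.isZmodule.Build SG gr_addA gr_addC gr_add0 gr_addN.

Fact gr_mulA : associative gr_mul.
Proof.
move=> a b c; apply/gcoefP => g; rewrite !ffunE.
under eq_bigr do rewrite ffunE mulr_sumr.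
under [RHS]eq_bigr do rewrite ffunE mulr_suml.
rewrite [RHS]exchange_big; apply: eq_bigr => h _.
rewrite (reindex_inj (mulgI h^-1%g)).
by apply: eq_bigr => k _; rewrite mulrA invMg invgK mulgA mulgK.
Qed.
Fact gr_mul1 : left_id gr_one gr_mul.
Proof.
move=> a; apply/gcoefP => g; rewrite ffunE (bigD1 1%g) //= ffunE eqxx mul1r.
rewrite invg1 mul1g big1 ?addr0 // => h /negPf h1.
by rewrite ffunE h1 mul0r.
Qed.
Fact gr_mulr1 : right_id gr_one gr_mul.
Proof.
move=> a; apply/gcoefP => g; rewrite ffunE (bigD1 g) //= ffunE mulVg eqxx mulr1.
rewrite big1 ?addr0 // => h hg.
by rewrite ffunE -eq_mulVg1 (negPf hg) mulr0.
Qed.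
Fact gr_mulDl : left_distributive gr_mul +%R.
Proof.
move=> a b c; apply/gcoefP => g; rewrite !ffunE -big_split.
by apply: eq_bigr => h _; rewrite ffunE mulrDl.
Qed.
Fact gr_mulDr : right_distributive gr_mul +%R.
Proof.
move=> a b c; apply/gcoefP => g; rewrite !ffunE -big_split.
by apply: eq_bigr => h _; rewrite ffunE mulrDr.
Qed.
Fact gr_one_neq0 : gr_one != 0.
Proof.
apply/eqP => /gcoefP/(_ 1%g); rewrite !ffunE eqxx => /eqP.
by rewrite oner_eq0.
Qed.

HB.instance Definition _ := GRing.Zmodule_isNzRing.Build SG
  gr_mulA gr_mul1 gr_mulr1 gr_mulDl gr_mulDr gr_one_neq0.

Lemma gcoefD a b g : gcoef (a + b) g = gcoef a g + gcoef b g.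
Proof. by rewrite ffunE. Qed.
Lemma gcoefN a g : gcoef (- a) g = - gcoef a g.
Proof. by rewrite ffunE. Qed.
Lemma gcoef0 g : gcoef (0 : SG) g = 0.
Proof. by rewrite ffunE. Qed.
Lemma gcoef1 g : gcoef (1 : SG) g = (g == 1%g)%:R.
Proof. by rewrite ffunE. Qed.
Lemma gcoefM a b g :
  gcoef (a * b) g = \sum_(h : G) gcoef a h * gcoef b (h^-1 * g)%g.
Proof. by rewrite ffunE. Qed.

End GroupRing.

HB.instance Definition _ (S : finNzRingType) (G : finGroupType) :=
  [Finite of group_ring S G by <:].

(* GRing.unit on S[G] is the set of two-sided invertible elements. *)
HB.instance Definition _ (S : finNzRingType) (G : finGroupType) :=
  FinRing.isNzRing.Build (group_ring S G).

(* Every subgroup A of the additive group of R that contains the units of R is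
   the whole of R. *)
Definition additively_generated_by_units (R : unitRingType) : Prop :=
  forall A : R -> Prop,
    A 0 -> (forall x y, A x -> A y -> A (x - y)) ->
    (forall u, u \is a GRing.unit -> A u) ->
  forall x, A x.

Definition n_sum_property (n : nat) (R : unitRingType) : Prop :=
  forall x : R, exists u : 'I_n -> R,
    (forall i, u i \is a GRing.unit) /\ x = \sum_(i < n) u i.

(* Main.v *)
Require Import Defs.
From HB Require Import structures.
From mathcomp Require Import all_boot all_fingroup all_algebra.

Set Implicit Arguments.
Unset Strict Implicit.
Unset Printing Implicit Defensive.

Import GRing.Theory.
Local Open Scope ring_scope.

(** Units pass between S and S[G] in both directions: s * g is a unit of S[G]
    for every unit s of S and every g in G, and the augmentation S[G] -> S is
    a surjective ring morphism.  Since S[G] is the direct sum of the subgroups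
    S * g, statement (1) follows.

    For (2), a finite ring R has the 2-sum property if and only if 1 is a sum
    of two units, that is, if and only if some u makes both u and 1 - u
    invertible ([n_sum_property2P]); such a u is carried from S to S[G] by the
    inclusion and back by the augmentation.

    The substance is therefore [sum_of_two_units]: given such a u, every x in
    R is a sum of two units.  The proof is a descent that replaces the
    Wedderburn-Artin decomposition of R modulo its Jacobson radical J.  Among
    the units w choose one for which the kernel modulo J of y = x - w, that
    is {k | y * k in J}, has the fewest elements.  If y were not a unit, some
    z outside J would satisfy y * z in J and z * y in J
    ([nonunit_annihilated]): z lies in the kernel of y, and it also detects
    what is outside the image of y.  Take a primitive idempotent f in R * z
    ([primitive_idem_exists]).  An element v * p with v in R * f and p in
    f * R has rank at most one, and when z * v and p * z are outside J,
    replacing w by w + v * p strictly shrinks the kernel of x - w.  The only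
    obstruction is that w + v * p may fail to be a unit, which happens exactly
    when f + p * w^-1 * v is in J ([rank_one_update]).  If that happened for
    all admissible v and p, the pairing p * w^-1 * v would be constantly -f
    modulo J on admissible pairs; splitting w^-1 * f as
    u * w^-1 * f + (1 - u) * w^-1 * f would then give -f - f = -f, so f would
    be in J ([rank_one_update_exists]).  Over F_2 the obstruction does occur,
    and there no such u exists. *)

(** * Units and powers in finite rings *)

(** Left multiplication by an element with a left inverse is injective, hence
    bijective by finiteness, so one-sided inverses are two-sided. *)
Lemma mulr1_unitl (R : finUnitRingType) (x y : R) :
  x * y = 1 -> x \is a GRing.unit.
Proof.
move=> xy1; have injy : injective ( *%R y).
  by move=> a b /(congr1 ( *%R x)); rewrite !mulrA xy1 !mul1r.
have [g _ gK] := injF_bij injy.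
have yg1 : y * g 1 = 1 by rewrite gK.
have gx : g 1 = x by rewrite -[LHS]mul1r -{1}xy1 -mulrA yg1 mulr1.
by apply/unitrP; exists y; split=> //; rewrite -gx.
Qed.

Lemma mulr1_unitr (R : finUnitRingType) (x y : R) :
  x * y = 1 -> y \is a GRing.unit.
Proof.
move=> xy1; have Ux := mulr1_unitl xy1.
by rewrite -(unitrMr _ Ux) xy1 unitr1.
Qed.

(** Jacobson's identity: if c inverts 1 + a * b, then 1 - b * c * a inverts
    1 + b * a. *)
Lemma unit_add1M_sym (R : finUnitRingType) (a b : R) :
  1 + a * b \is a GRing.unit -> 1 + b * a \is a GRing.unit.
Proof.
move=> Uab; pose c := (1 + a * b)^-1.
apply: (@mulr1_unitl _ _ (1 - b * c * a)).
have cE : (1 + a * b) * c = 1 by rewrite mulrV.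
have -> : (1 + b * a) * (1 - b * c * a) =
          1 + b * a - b * ((1 + a * b) * c) * a.
  by rewrite mulrBr mulr1 !mulrDl !mul1r !mulrDr !mulrDl !mulrA.
by rewrite cE mulr1 addrK.
Qed.

Lemma expr_eventually_periodic (R : finUnitRingType) (a : R) :
  exists i d, (0 < d)%N /\ a ^+ i = a ^+ (i + d).
Proof.
pose f (i : 'I_#|R|.+1) := a ^+ i.
have /injectivePn[i [j nij fij]] : ~~ injectiveb f.
  by apply/negP => /injectiveP/leq_card; rewrite card_ord ltnn.
wlog lt_ij : i j nij fij / (i < j)%N.
  move=> H; have := nij; rewrite -val_eqE neq_ltn => /orP[] lt.
    exact: (H i j).
  by apply: (H j i); rewrite // eq_sym.
by exists (i : nat), (j - i)%N; rewrite subn_gt0 lt_ij subnKC ?(ltnW lt_ij).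
Qed.

Lemma expr_idempotent (R : finUnitRingType) (a : R) :
  exists2 k, (0 < k)%N & a ^+ k * a ^+ k = a ^+ k.
Proof.
have [i [d [d_gt0 per]]] := expr_eventually_periodic a.
have step n m : (i <= n)%N -> a ^+ (n + m * d) = a ^+ n.
  move=> /subnKC <-; elim: m => [|m IH]; first by rewrite addn0.
  rewrite -[RHS]IH mulSn -!addnA (addnCA (n - i)%N) addnA.
  by rewrite exprD -per -exprD.
(* i.+1 rather than i, so that the exponent is positive when i = 0. *)
exists (i.+1 * d)%N; first by rewrite muln_gt0.
rewrite -exprD step //; apply: leq_trans (leqnSn i) _.
by rewrite -{1}[i.+1]muln1 leq_mul2l d_gt0 orbT.
Qed.

(** * The Jacobson radical of a finite ring *)

(** The two-sided form of quasi-regularity makes closure under multiplication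
    on both sides immediate. *)
Definition jacobson_radical (R : finUnitRingType) : {pred R} :=
  [pred x | [forall r, forall s, 1 + r * x * s \is a GRing.unit]].

Arguments jacobson_radical : clear implicits.

Section JacobsonRadical.
Variable R : finUnitRingType.
Local Notation J := (jacobson_radical R).
Implicit Types x y r s f : R.

Lemma radicalP x :
  reflect (forall r s, 1 + r * x * s \is a GRing.unit) (x \in J).
Proof.
apply: (iffP forallP) => [H r s|H r]; first by have /forallP := H r.
by apply/forallP.
Qed.

Lemma radicalMl r x : x \in J -> r * x \in J.
Proof. by move/radicalP=> H; apply/radicalP => a s; rewrite mulrA. Qed.

Lemma radicalMr r x : x \in J -> x * r \in J.
Proof. by move/radicalP=> H; apply/radicalP => a s; rewrite -!mulrA mulrA. Qed.

Lemma radical0 : 0 \in J.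
Proof. by apply/radicalP => r s; rewrite mulr0 mul0r addr0 unitr1. Qed.

Lemma radicalN x : (- x \in J) = (x \in J).
Proof.
by apply/idP/idP => /(radicalMl (-1)); rewrite mulN1r ?opprK.
Qed.

Lemma radicalD x y : x \in J -> y \in J -> x + y \in J.
Proof.
move=> /radicalP Jx /radicalP Jy; apply/radicalP => r s.
have Ux := Jx r s.
have -> : 1 + r * (x + y) * s =
   (1 + r * x * s) * (1 + (1 + r * x * s)^-1 * r * y * s).
  by rewrite [RHS]mulrDr mulr1 !mulrA mulrV // mul1r mulrDr mulrDl addrA.
by rewrite unitrMr // Jy.
Qed.

Lemma radicalB x y : x \in J -> y \in J -> x - y \in J.
Proof. by move=> Jx Jy; rewrite radicalD ?radicalN. Qed.

Lemma radical_idem f : f * f = f -> f \in J -> f = 0.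
Proof.
move=> ff /radicalP/(_ (-1) 1); rewrite mulr1 mulN1r => U1f.
by apply: (mulIr U1f); rewrite mul0r mulrBr mulr1 ff subrr.
Qed.

(** Outside the radical some 1 + r * x is not invertible, so r * x is not
    nilpotent, and by finiteness one of its powers is idempotent. *)
Lemma idem_left_multiple x : x \notin J ->
  exists r, [/\ r * x != 0 & (r * x) * (r * x) = r * x].
Proof.
move=> nJx; have [r Ur] : exists r, 1 + r * x \isn't a GRing.unit.
  move: nJx; rewrite inE negb_forall => /existsP[r].
  rewrite negb_forall => /existsP[s nU]; exists (s * r).
  apply: contra nU => U; rewrite -mulrA.
  by rewrite -mulrA in U; have := unit_add1M_sym U; rewrite mulrA.
have [[//|k] _ idk] := expr_idempotent (r * x).
exists ((r * x) ^+ k * r); rewrite -mulrA -exprSr; split=> //.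
apply: contra Ur => /eqP a0; apply/unitrP.
(* The geometric series inverts 1 + r * x when r * x is nilpotent. *)
have := subrX1 (- (r * x)) k.+1.
rewrite exprNn a0 mulr0 sub0r => /esym E.
have {}E : (1 + r * x) * \sum_(i < k.+1) (- (r * x)) ^+ i = 1.
  by apply: oppr_inj; rewrite -mulNr opprD addrC E.
by apply/unitrP; apply: mulr1_unitl E.
Qed.

Lemma radical_unit y : 1 - y \in J -> y \is a GRing.unit.
Proof.
move=> /radicalP/(_ (-1) 1).
by rewrite mulr1 mulN1r opprB addrC subrK.
Qed.

(** The powers of y satisfy y ^ i * (1 - y ^ d) = 0 with d > 0.  Take the
    least i for which this element is in the radical; if i = 0 then y ^ d,
    hence y, is a unit, and otherwise z = y ^ (i - 1) * (1 - y ^ d) works.  It annihilates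
    y on both sides because it is a polynomial in y. *)
Lemma nonunit_annihilated y : y \isn't a GRing.unit ->
  exists z, [/\ z \notin J, y * z \in J & z * y \in J].
Proof.
move=> nUy; have [i0 [d [d_gt0 per]]] := expr_eventually_periodic y.
have exi : exists i, y ^+ i * (1 - y ^+ d) \in J.
  by exists i0; rewrite mulrBr mulr1 -exprD -per subrr radical0.
case: (ex_minnP exi) => -[|i] Ji mini.
  case/negP: nUy; rewrite -(unitrX_pos _ d_gt0).
  by apply: radical_unit; rewrite expr0 mul1r in Ji.
exists (y ^+ i * (1 - y ^+ d)); rewrite mulrA -exprS Ji; split=> //.
  by apply/negP => /mini; rewrite ltnn.
have comm : (1 - y ^+ d) * y = y * (1 - y ^+ d).
  by rewrite mulrBl mulrBr mul1r mulr1 -exprS -exprSr.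
by rewrite -mulrA comm mulrA -exprSr.
Qed.

(** * Primitive idempotents *)

(** The last clause says that the corner ring f * R * f is local: its elements
    outside the radical of R are left invertible. *)
Definition primitive_idem f :=
  [/\ f != 0, f * f = f &
      forall d, d \notin J -> f * d * f = d -> exists s, s * d = f].

(** Take a nonzero idempotent f of R * z whose left ideal R * f is as small as
    possible: for d in f * R * f outside the radical, R * d contains a nonzero
    idempotent, which generates R * f by minimality. *)
Lemma primitive_idem_exists z : z \notin J ->
  exists f, primitive_idem f /\ exists s, f = s * z.
Proof.
move=> nJz; have [r0 [nz0 id0]] := idem_left_multiple nJz.
pose P f := [&& f != 0, f * f == f & [exists s, f == s * z]].
have P0 : P (r0 * z).
  by apply/and3P; split=> //; [apply/eqP | apply/existsP; exists r0].
pose m f := #|[set s * f | s : R]|.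
case: (arg_minnP m P0) => f /and3P[nzf /eqP ff /existsP[s /eqP fE]] minf.
exists f; split; last by exists s.
split=> // d nJd dE; have [r [nzg idg]] := idem_left_multiple nJd.
have gE : r * d = r * (f * d) * f by rewrite -mulrA dE.
have Pg : P (r * d).
  apply/and3P; split=> //; first exact/eqP.
  by apply/existsP; exists (r * (f * d) * s); rewrite gE fE !mulrA.
have sub : [set t * (r * d) | t : R] \subset [set t * f | t : R].
  apply/subsetP => _ /imsetP[t _ ->]; apply/imsetP.
  by exists (t * (r * (f * d))); rewrite // gE !mulrA.
have /eqP eqS : [set t * (r * d) | t : R] == [set t * f | t : R].
  by rewrite eqEcard sub minf.
have : f \in [set t * f | t : R] by apply/imsetP; exists f.
by rewrite -eqS => /imsetP[t _ ->]; exists (t * r); rewrite mulrA.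
Qed.

Lemma idem_not_radical f : f != 0 -> f * f = f -> f \notin J.
Proof. by move=> /eqP nzf ff; apply/negP => /(radical_idem ff). Qed.

(** This is the semiprimeness of R modulo its radical: v * R * v is in the
    radical since v = v * f.  A nonzero idempotent a * v would be equal to
    a * v * (f * a * v), which is in the radical. *)
Lemma corner_detect (f v : R) :
  v * f = v -> (forall r, f * r * v \in J) -> v \in J.
Proof.
move=> vf Jv; apply: contraT => nJv.
have [a [nzg idg]] := idem_left_multiple nJv.
case/negP: (idem_not_radical nzg idg).
have -> : a * v = a * v * (f * a * v).
  by rewrite !mulrA -(mulrA a v f) vf -!mulrA mulrA idg.
exact: radicalMl.
Qed.

(** * Sums of two units *)

(** Modulo the radical, v is a column in R * f and p a row in f * R, paired into
    f * R * f by p * w^-1 * v; they are admissible when z * v and p * z are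
    outside the radical.  Suppose that the pairing is -f on all admissible
    pairs.  Adding a non-admissible column to an admissible one keeps it
    admissible, so a non-admissible column pairs to 0 with admissible rows,
    likewise with all rows, and is therefore 0.  Hence the columns
    w * u * w^-1 * f and w * (1 - u) * w^-1 * f, which are not 0, are
    admissible, and so is their sum f: pairing each with the same row gives
    -f - f = -f. *)
Lemma rank_one_update_exists (u f z s w : R) :
  u \is a GRing.unit -> 1 - u \is a GRing.unit ->
  f != 0 -> f * f = f -> f = s * z -> w \is a GRing.unit ->
  exists v p, [/\ v * f = v, f * p = p, z * v \notin J, p * z \notin J &
                  f + p * w^-1 * v \notin J].
Proof.
move=> Uu U1u nzf ff fE Uw; have nJf := idem_not_radical nzf ff.
pose col v := (v * f == v) && (z * v \notin J).
pose row p := (f * p == p) && (p * z \notin J).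
have [/existsP[v /existsP[p /and3P[]]]|] :=
  boolP [exists v, exists p,
           [&& col v, row p & f + p * w^-1 * v \notin J]].
  by move=> /andP[/eqP ? ?] /andP[/eqP ? ?] ?; exists v, p.
rewrite negb_exists => /forallP noVP.
have bad v p : col v -> row p -> f + p * w^-1 * v \in J.
  move=> cv rp; have := noVP v; rewrite negb_exists => /forallP/(_ p).
  by rewrite cv rp negbK.
have colf : col f.
  rewrite /col ff eqxx; apply: contra nJf => /(radicalMl s).
  by rewrite mulrA -fE ff.
have rowfs : row (f * s) by rewrite /row mulrA ff eqxx -mulrA -fE ff.
have addJ a b : b \in J -> (a + b \in J) = (a \in J).
  move=> Jb; apply/idP/idP => [|Ja]; last exact: radicalD.
  by move/radicalB/(_ Jb); rewrite addrK.
have pairing0 v p : v * f = v -> z * v \in J -> row p -> p * w^-1 * v \in J.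
  move=> vf Jzv rp; have cfv : col (f + v).
    by rewrite /col mulrDl ff vf eqxx mulrDr addJ //; case/andP: colf.
  have := radicalB (bad _ _ cfv rp) (bad _ _ colf rp).
  by rewrite mulrDr opprD addrACA subrr add0r addrAC subrr add0r.
have inadmissible0 v : v * f = v -> z * v \in J -> v \in J.
  move=> vf Jzv; have Jtv : w^-1 * v \in J.
    apply: (corner_detect (f := f)) => [|r]; first by rewrite -mulrA vf.
    rewrite mulrA; pose p := f * r; have fp : f * p = p by rewrite /p mulrA ff.
    have [Jpz|nJpz] := boolP (p * z \in J); last first.
      by apply: pairing0; rewrite // /row fp eqxx.
    (* An inadmissible row is a difference of two admissible ones. *)
    have rp : row (p + f * s).
      have /andP[/eqP f_fs nJfsz] := rowfs.
      by rewrite /row mulrDr fp f_fs eqxx mulrDl addrC addJ.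
    have := radicalB (pairing0 _ _ vf Jzv rp) (pairing0 _ _ vf Jzv rowfs).
    by rewrite -mulrBl -mulrBl addrK.
  by have := radicalMl w Jtv; rewrite mulVKr.
have twist_radical a :
    a \is a GRing.unit -> w * a * w^-1 * f \in J -> f \in J.
  move=> Ua /(radicalMl (w * a^-1 * w^-1)).
  by rewrite !mulrA mulrVK // mulrVK // mulrV // mul1r.
pose v1 := w * u * w^-1 * f; pose v2 := w * (1 - u) * w^-1 * f.
have v12 : v1 + v2 = f.
  by rewrite -mulrDl -mulrDl -mulrDr addrC subrK mulr1 mulrV // mul1r.
have colN a : a \is a GRing.unit -> col (w * a * w^-1 * f).
  move=> Ua; have vf : w * a * w^-1 * f * f = w * a * w^-1 * f.
    by rewrite -mulrA ff.
  rewrite /col vf eqxx; apply/negP.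
  move=> /(inadmissible0 _ vf)/(twist_radical _ Ua).
  exact/negP.
have Ju := bad _ _ (colN _ Uu) rowfs; have J1u := bad _ _ (colN _ U1u) rowfs.
have := radicalB (radicalD Ju J1u) (bad _ _ colf rowfs).
rewrite addrACA -mulrDr -/v1 -/v2 v12 -(addrA f f) addrK => Jf.
by rewrite Jf in nJf.
Qed.

Definition radical_kernel (y : R) := [set x | y * x \in J].

(** With c = p * w^-1 * v, the element w + v * p is a unit as soon as 1 + c is,
    and 1 + c is the sum of 1 - f and of f + c, which is a unit of the local
    ring f * R * f.  If (y - v * p) * x is in the radical,
    multiplying by z on the left removes y and leaves z * v * p * x, where z * v
    can be cancelled by primitivity of f; so p * x and then y * x are in the
    radical.  Finally z is in the kernel of y but not in the new kernel, as
    p * z is outside the radical. *)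
Lemma rank_one_update (f y z v p w : R) :
  primitive_idem f -> w \is a GRing.unit ->
  y * z \in J -> z * y \in J ->
  v * f = v -> f * p = p -> z * v \notin J -> p * z \notin J ->
  f + p * w^-1 * v \notin J ->
  w + v * p \is a GRing.unit /\
  radical_kernel (y - v * p) \proper radical_kernel y.
Proof.
move=> [nzf ff prim] Uw Jyz Jzy vf fp nJzv nJpz nJfp; split.
  set c := p * w^-1 * v in nJfp.
  have fc : f * c = c by rewrite /c !mulrA fp.
  have cf : c * f = c by rewrite /c -!mulrA vf.
  have [|h hE] := prim _ nJfp; first by rewrite mulrDr ff fc mulrDl ff cf.
  suff U1c : 1 + c \is a GRing.unit.
    have -> : w + v * p = w * (1 + w^-1 * v * p).
      by rewrite mulrDr mulr1 !mulrA mulrV // mul1r.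
    by rewrite unitrMr //; apply: unit_add1M_sym; rewrite mulrA.
  apply: (@mulr1_unitr _ (h * f + (1 - f))).
  have -> : (h * f + (1 - f)) * (1 + c) = h * (f + c) + (1 - f).
    rewrite mulrDr mulr1 mulrDl -(mulrA h f c) fc mulrBl mul1r fc subrr addr0.
    by rewrite mulrDr addrAC.
  by rewrite hE addrC subrK.
have cancel x : z * v * p * x \in J -> p * x \in J.
  move=> Jx; have zvf : z * v * f = z * v by rewrite -mulrA vf.
  have [r nJr] : exists r, f * r * (z * v) \notin J.
    apply/existsP; apply: contraNT nJzv; rewrite negb_exists => /forallP H.
    by apply: (corner_detect zvf) => r; have := H r; rewrite negbK.
  have [|a aE] := prim _ nJr; first by rewrite !mulrA ff -!mulrA vf.
  by rewrite -fp -aE -!mulrA radicalMl // radicalMl // radicalMl // !mulrA.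
apply/properP; split.
  apply/subsetP => x; rewrite !inE mulrBl => Jx.
  have Jpx : p * x \in J.
    apply: cancel; have := radicalB (radicalMr x Jzy) (radicalMl z Jx).
    by rewrite mulrBr !mulrA opprB addrC subrK.
  by have := radicalD Jx (radicalMl v Jpx); rewrite mulrA subrK.
exists z; rewrite inE ?mulrBl //; apply: contra nJpz => Jx; apply: cancel.
by have := radicalMl z (radicalB Jyz Jx); rewrite opprB addrC subrK !mulrA.
Qed.

(** A unit w minimizing the kernel of x - w modulo the radical admits no
    shrinking rank one update, so x - w is a unit. *)
Theorem sum_of_two_units (u x : R) :
  u \is a GRing.unit -> 1 - u \is a GRing.unit ->
  exists w, w \is a GRing.unit /\ x - w \is a GRing.unit.
Proof.
move=> Uu U1u; pose m w := #|radical_kernel (x - w)|.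
have U1 : (1 : R) \is a GRing.unit by apply: unitr1.
case: (arg_minnP m U1) => w Uw minw; exists w; split=> //.
apply: contraT => /nonunit_annihilated[z [nJz Jyz Jzy]].
have [f [primf [s fE]]] := primitive_idem_exists nJz.
have [nzf ff _] := primf.
have [v [p [vf fp nJzv nJpz nJfp]]] :=
  rank_one_update_exists Uu U1u nzf ff fE Uw.
have [Uw' /proper_card] :=
  rank_one_update primf Uw Jyz Jzy vf fp nJzv nJpz nJfp.
by rewrite -addrA -opprD ltnNge => /negP[]; apply: minw.
Qed.

End JacobsonRadical.

Lemma n_sum_property2P (R : finUnitRingType) :
  n_sum_property 2 R <->
  exists u : R, u \is a GRing.unit /\ 1 - u \is a GRing.unit.
Proof.
split=> [/(_ 1)[u [Uu E]]|[u [Uu U1u]] x].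
  exists (u ord0); split=> //.
  by rewrite E big_ord_recl big_ord1 addrC addKr.
have [w [Uw Uxw]] := sum_of_two_units x Uu U1u.
exists (fun i => if i == ord0 then w else x - w).
split=> [i|]; first by case: ifP.
by rewrite big_ord_recl big_ord1 /= addrC subrK.
Qed.

(** * Monomials and augmentation of a group ring *)

Section GroupRingTheory.
Variables (S : finUnitRingType) (G : finGroupType).
Local Notation SG := (group_ring S G).
Implicit Types (a b : SG) (s t : S) (g h : G).

Definition monomial s g : SG := GroupRing [ffun h => if h == g then s else 0].

Lemma gcoef_monomial s g h : gcoef (monomial s g) h = if h == g then s else 0.
Proof. by rewrite ffunE. Qed.

Lemma monomial1 : monomial 1 1%g = 1.
Proof. by apply/gcoefP => h; rewrite gcoef_monomial gcoef1; case: eqP. Qed.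

Lemma monomial0 g : monomial 0 g = 0.
Proof. by apply/gcoefP => h; rewrite gcoef_monomial gcoef0; case: eqP. Qed.

Lemma monomialB s t g : monomial (s - t) g = monomial s g - monomial t g.
Proof.
apply/gcoefP => h; rewrite gcoefD gcoefN !gcoef_monomial.
by case: eqP; rewrite ?subrr.
Qed.

Lemma monomialM s t g h :
  monomial s g * monomial t h = monomial (s * t) (g * h)%g.
Proof.
apply/gcoefP => k; rewrite gcoefM (bigD1 g) //= !gcoef_monomial eqxx.
rewrite big1 => [|i].
  by rewrite addr0 (can2_eq (mulKVg g) (mulKg g)); case: eqP; rewrite ?mulr0.
by move=> /negPf ig; rewrite gcoef_monomial ig mul0r.
Qed.

Lemma sum_monomial a : \sum_g monomial (gcoef a g) g = a.
Proof.
have gsum (F : G -> SG) h : gcoef (\sum_g F g) h = \sum_g gcoef (F g) h.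
  apply: (big_morph (fun c : SG => gcoef c h)) => [b c|]; first exact: gcoefD.
  exact: gcoef0.
apply/gcoefP => h; rewrite gsum (bigD1 h) //= gcoef_monomial eqxx.
rewrite big1 ?addr0 // => g.
by rewrite gcoef_monomial eq_sym => /negPf ->.
Qed.

Lemma monomial_unit s g : s \is a GRing.unit -> monomial s g \is a GRing.unit.
Proof.
move=> Us; apply: (@mulr1_unitl _ _ (monomial s^-1 g^-1%g)).
by rewrite monomialM mulrV // mulgV monomial1.
Qed.

Definition augmentation a : S := \sum_g gcoef a g.

Lemma augmentation_monomial s g : augmentation (monomial s g) = s.
Proof.
rewrite /augmentation (bigD1 g) //= gcoef_monomial eqxx big1 ?addr0 // => h.
by rewrite gcoef_monomial => /negPf ->.
Qed.

Lemma augmentation1 : augmentation 1 = 1.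
Proof. by rewrite -monomial1 augmentation_monomial. Qed.

Lemma augmentation0 : augmentation 0 = 0.
Proof. by rewrite -(monomial0 1%g) augmentation_monomial. Qed.

Lemma augmentationB a b :
  augmentation (a - b) = augmentation a - augmentation b.
Proof.
by rewrite /augmentation -sumrB; apply: eq_bigr => g _; rewrite gcoefD gcoefN.
Qed.

Lemma augmentationM a b :
  augmentation (a * b) = augmentation a * augmentation b.
Proof.
rewrite /augmentation mulr_suml; under eq_bigr do rewrite gcoefM.
rewrite exchange_big; apply: eq_bigr => h _; rewrite mulr_sumr.
by rewrite (reindex_inj (mulgI h)); apply: eq_bigr => g _; rewrite mulKg.
Qed.

Lemma augmentation_unit a :
  a \is a GRing.unit -> augmentation a \is a GRing.unit.
Proof.
move=> Ua; apply: (@mulr1_unitl _ _ (augmentation a^-1)).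
by rewrite -augmentationM mulrV // augmentation1.
Qed.

End GroupRingTheory.

(* A finUnitRingType is an arbitrary finite nontrivial ring: the unit structure
   is determined by the ring operations (units are the two-sided invertible
   elements) and FinRing.isNzRing provides it for every finNzRingType. *)
Theorem proposition2p5 (G : finGroupType) (S : finUnitRingType) :
  (additively_generated_by_units (group_ring S G) <->
   additively_generated_by_units S) /\
  (n_sum_property 2 S <-> n_sum_property 2 (group_ring S G)).
Proof.
split; last first.
  split=> /n_sum_property2P[u [Uu U1u]]; apply/n_sum_property2P.
    exists (monomial u 1%g); rewrite -monomial1 -monomialB.
    by split; apply: monomial_unit.
  exists (augmentation u); rewrite -(augmentation1 S G) -augmentationB.
  by split; apply: augmentation_unit.
split=> gen A A0 AB AU x.
  rewrite -(augmentation_monomial x (1%g : G)).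
  apply: (gen (fun a => A (augmentation a))) => [|a b Aa Ab|a Ua].
  - by rewrite augmentation0.
  - by rewrite augmentationB; apply: AB.
  - exact: AU (augmentation_unit Ua).
rewrite -(sum_monomial x).
apply: (big_ind A) => // [a b Aa Ab|g _].
  have AN : A (- b) by rewrite -sub0r; apply: AB.
  by rewrite -[b]opprK; apply: AB.
apply: (gen (fun s => A (monomial s g))) => [|s t As At|s Us].
- by rewrite monomial0.
- by rewrite monomialB; apply: AB.
- exact: AU (monomial_unit g Us).
Qed.
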